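(* Let $(X,d)$ be a complete CAT(0) space and let $f : X \to (-\infty,\infty]$ be a lower semicontinuous proper function whose set of minimizers $Argmin(f)$ is nonempty. Assume that $f$ is uniformly convex with modulus $\varphi$. Let $x\in X$ and $b>0$ be such that $d(x,p)\leq b$ for some minimizer $p$ of $f$, and let $(\gamma_n)_{n\in\mathbb{N}}$ be a sequence in $(0,\infty)$ such that $\sum_{n=0}^\infty \gamma_n = \infty$ with rate of divergence $\theta:\mathbb{N}\to\mathbb{N}$. Let $(x_n)$ be the proximal point algorithm starting with $x$, i.e. $x_0:=x$ and $x_{n+1}:=J_{\gamma_n}x_n$ for all $n\in\mathbb{N}$. Define $$\Sigma_{b,\theta,\varphi}:\mathbb{N}\to\mathbb{N}, \quad \Sigma_{b,\theta,\varphi}(k)= \beta_{b,\theta}\left(\left\lceil\frac{8}{\varphi\left(\frac1{k+1}\right)}\right\rceil \right),$$ where $$\beta_{b, \theta}:\mathbb{N}\to\mathbb{N}, \quad \beta_{b, \theta}(k)=\theta^M\left(\left\lceil \frac{b^2(k+1)}2 \right\rceil \right) +1.$$ Then $(x_n)$ converges, $\Sigma_{b,\theta,\varphi}$ is a rate of convergence for $(x_n)$, and the limit of $(x_n)$ is a minimizer of $f$.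
   Context: $\mathbb{N}=\{0,1,2,\ldots\}$. A geodesic in a metric space $(X,d)$ is a map $\gamma:[a,b]\to X$ with $d(\gamma(s),\gamma(t))=|s-t|$ for all $s,t\in[a,b]$. A geodesic space is a metric space in which every two points are joined by a geodesic. A CAT(0) space is a geodesic space $(X,d)$ such that for all $z\in X$, all geodesics $\gamma:[a,b]\to X$ and all $t\in[0,1]$, $$d^2(z,\gamma((1-t)a+tb)) \leq (1-t)d^2(z,\gamma(a)) + td^2(z,\gamma(b)) - t(1-t)d^2(\gamma(a),\gamma(b)).$$ CAT(0) spaces are uniquely geodesic; for $x,y\in X$ and $t\in[0,1]$, $(1-t)x+ty$ denotes the point $\gamma(t\,d(x,y))$, where $\gamma:[0,d(x,y)]\to X$ is the unique geodesic with $\gamma(0)=x$, $\gamma(d(x,y))=y$. A function $f:X\to(-\infty,\infty]$ is proper if it is not identically $+\infty$. It is uniformly convex with modulus $\varphi$ (a modulus of uniform convexity) if $\varphi:[0,\infty)\to[0,\infty]$ is a nondecreasing function vanishing only at $0$ such that for all $x,y\in X$ and all $t\in[0,1]$, $$f((1-t)x + ty) \leq (1-t) f(x) + tf(y) - t(1-t)\varphi(d(x,y)).$$ Conventions for infinite values: $0\cdot\infty=0$; the inequality is regarded as trivially satisfied when its term $(1-t)f(x)+tf(y)$ equals $+\infty$; and $8/\infty=0$. For a convex, lower semicontinuous, proper $f$ on a complete CAT(0) space $X$ and $\gamma>0$, the resolvent (proximal mapping) of $f$ of order $\gamma$ is $$J_\gamma:X\to X,\quad J_\gamma(x)={\arg\min}_{y\in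 X}\left[f(y)+\frac1{2\gamma}d^2(x,y)\right];$$ it is known that this minimizer exists and is unique. For $h:\mathbb{N}\to\mathbb{N}$, $h^M:\mathbb{N}\to\mathbb{N}$ is defined by $h^M(n)=\max_{i\leq n}h(i)$. A rate of divergence of $\sum_{n=0}^\infty\gamma_n=\infty$ is a mapping $\theta:\mathbb{N}\to\mathbb{N}$ with $\sum_{n=0}^{\theta(P)}\gamma_n\geq P$ for all $P\in\mathbb{N}$. A rate of convergence of a sequence $(a_n)$ converging to $a$ in a metric space is a mapping $\rho:\mathbb{N}\to\mathbb{N}$ such that for all $k\in\mathbb{N}$ and all $n\geq\rho(k)$, $d(a_n,a)\leq\frac1{k+1}$. *)

(* Defs.v *)
From HB Require Import structures.
From mathcomp Require Import all_boot all_order all_algebra.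
From mathcomp Require Import ring.
From mathcomp Require Import all_classical all_reals all_analysis.

Set Implicit Arguments.
Unset Strict Implicit.
Unset Printing Implicit Defensive.

Import Order.TTheory GRing.Theory Num.Theory.
Import numFieldNormedType.Exports.

Local Open Scope classical_set_scope.
Local Open Scope ring_scope.

#[short(type="completeMetricType")]
HB.structure Definition CompleteMetric (K : numDomainType) :=
  { T of Metric K T & Complete T }.

Section CAT0.
Context {R : realType} {X : metricType R}.

(* A map [a, b] -> X is represented by a total map of which only the values on
   [a, b] matter. *)
Definition is_geodesic (a b : R) (g : R -> X) : Prop :=
  a <= b /\
  forall s t, s \in `[a, b] -> t \in `[a, b] -> mdist (g s) (g t) = `|s - t|.

Definition geodesic_from_to (x y : X) (g : R -> X) : Prop :=
  [/\ is_geodesic 0 (mdist x y) g, g 0 = x & g (mdist x y) = y].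

End CAT0.

Definition geodesic_space {R : realType} (X : metricType R) : Prop :=
  forall x y : X, exists a b (g : R -> X),
    [/\ is_geodesic a b g, g a = x & g b = y].

Definition CAT0 {R : realType} (X : metricType R) : Prop :=
  geodesic_space X /\
  forall (z : X) (a b : R) (g : R -> X), is_geodesic a b g ->
  forall t : R, 0 <= t <= 1 ->
    mdist z (g ((1 - t) * a + t * b)) ^+ 2 <=
      (1 - t) * mdist z (g a) ^+ 2 + t * mdist z (g b) ^+ 2
      - t * (1 - t) * mdist (g a) (g b) ^+ 2.

(* The point (1 - t) x + t y: g (t * d(x, y)) for the geodesic g from x to y.
   It is well defined in a CAT(0) space when 0 <= t <= 1, see geo_combE below;
   otherwise the value is arbitrary. *)
Definition geo_comb {R : realType} {X : completeMetricType R}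
    (t : R) (x y : X) : X :=
  get [set w | exists2 g : R -> X,
                 geodesic_from_to x y g & w = g (t * mdist x y)].

Lemma geo_combE {R : realType} {X : completeMetricType R} (t : R) (x y : X)
    (g : R -> X) :
  CAT0 X -> 0 <= t <= 1 -> geodesic_from_to x y g ->
  geo_comb t x y = g (t * mdist x y).
Proof.
move=> [_ catX] t01 gxy; have /andP[t0 t1] := t01.
have [[d0 _] g0 g1] := gxy.
rewrite /geo_comb; case: xgetP => [_ -> [h [[_ hd] h0 h1] ->]|]; last first.
  by move=> /(_ (g (t * mdist x y))) []; exists g.
have tD0 : 0 <= t * mdist x y by rewrite mulr_ge0.
have tDD : t * mdist x y <= mdist x y by rewrite ler_piMl.
have hx : mdist (h (t * mdist x y)) x = t * mdist x y.
  by rewrite -[X in mdist _ X]h0 hd ?in_itv/= ?lexx ?tD0// subr0 ger0_norm.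
have hy : mdist (h (t * mdist x y)) y = (1 - t) * mdist x y.
  rewrite -[X in mdist _ X]h1 hd ?in_itv/= ?lexx ?tD0 ?d0// distrC.
  by rewrite ger0_norm ?subr_ge0// mulrBl mul1r.
have := catX (h (t * mdist x y)) _ _ _ (let: And3 H _ _ := gxy in H) t t01.
rewrite mulr0 add0r g0 g1 hx hy => h2.
apply: mdist_positivity; apply/eqP; rewrite -sqrf_eq0 eq_le sqr_ge0 andbT.
apply: le_trans h2 _; rewrite le_eqVlt; apply/orP; left; apply/eqP; ring.
Qed.

Section functions.
Context {R : realType} {X : completeMetricType R}.
Implicit Types (f : X -> \bar R) (phi : R -> \bar R).
Local Open Scope ereal_scope.

(* f takes its values in (-oo, +oo] *)
Definition no_ninfty f : Prop := forall x, f x != -oo.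

Definition proper_fun f : Prop := exists x, f x != +oo.

Definition Argmin f : set X := [set p | forall y, f p <= f y].

(* Only the values of phi on [0, +oo) matter. *)
Definition uc_modulus phi : Prop :=
  [/\ forall r : R, (0 <= r)%R -> 0 <= phi r,
      forall r s : R, (0 <= r)%R -> (r <= s)%R -> phi r <= phi s &
      forall r : R, (0 <= r)%R -> phi r = 0 <-> r = 0%R].

(* The guard is needed because +oo - +oo = -oo in \bar R. *)
Definition uniformly_convex f phi : Prop :=
  uc_modulus phi /\
  forall (x y : X) (t : R), (0 <= t <= 1)%R ->
    let m := (1 - t)%:E * f x + t%:E * f y in
    m != +oo ->
    f (geo_comb t x y) <= m - (t * (1 - t))%:E * phi (mdist x y).

(* The proximal mapping J_gam; the value is arbitrary when there is no
   minimizer. *)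
Definition resolvent f (gam : R) (x : X) : X :=
  get (Argmin (fun y => f y + ((2 * gam)^-1 * mdist x y ^+ 2)%:E)).

Fixpoint prox_point f (gam : nat -> R) (x : X) (n : nat) : X :=
  if n is m.+1 then resolvent f (gam m) (prox_point f gam x m) else x.

End functions.

Section rates.
Context {R : realType}.

Definition rate_of_divergence (gam : nat -> R) (theta : nat -> nat) : Prop :=
  forall P : nat, P%:R <= \sum_(0 <= n < (theta P).+1) gam n.

Definition rate_of_convergence {X : metricType R} (u : nat -> X) (l : X)
    (rho : nat -> nat) : Prop :=
  forall k n : nat, (rho k <= n)%N -> mdist (u n) l <= k.+1%:R^-1.

Definition hmax (h : nat -> nat) (n : nat) : nat := \max_(i < n.+1) h i.

(* the ceiling of a nonnegative real number, as a natural number *)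
Definition ceiln (r : R) : nat := `|Num.ceil r|%N.

Definition beta_rate (b : R) (theta : nat -> nat) (k : nat) : nat :=
  (hmax theta (ceiln (b ^+ 2 * k.+1%:R / 2)) + 1)%N.

(* Division in \bar R satisfies 8 / +oo = 0, so that the argument of fine is
   finite as soon as phi is a modulus of uniform convexity. *)
Definition Sigma_rate (b : R) (theta : nat -> nat) (phi : R -> \bar R) (k : nat) :
    nat :=
  beta_rate b theta (ceiln (fine (8%:E / phi (k.+1%:R^-1)%R)%E)).

End rates.

(* Main.v *)
Require Import Defs.
From HB Require Import structures.
From mathcomp Require Import all_boot all_order all_algebra.
From mathcomp Require Import ring lra.
From mathcomp Require Import all_classical all_reals all_analysis.

(** Comparing y = J_gamma x with the points (1 - t) y + t z, and letting t tend
    to 0, gives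
    [2 gamma (f y - f z) + d(x, y)^2 + d(y, z)^2 <= d(x, z)^2].
    With z = x this makes f decrease along the algorithm; with z = p a minimizer
    and summing, [2 (f x_n - min f) * sum_(i < n) gamma_i <= b^2]. Uniform
    convexity at the midpoint of x_n and p bounds phi (d(x_n, p)) by
    [2 (f x_n - min f)], which turns this estimate into a rate of convergence
    of x_n to p. The minimizer defining J_gamma x exists because minimizing
    sequences of the penalised, strongly convex function are Cauchy. *)

Set Implicit Arguments.
Unset Strict Implicit.
Unset Printing Implicit Defensive.

Import Order.TTheory GRing.Theory Num.Theory.
Import numFieldNormedType.Exports.

Local Open Scope classical_set_scope.
Local Open Scope ring_scope.

(** * Distances, geodesics and convex combinations *)

Lemma cvg_mdistr {R : realType} {X : metricType R} {T : Type}
    {F : set_system T} {FF : Filter F} (u : T -> X) (x y : X) :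
  u @ F --> y -> mdist x (u t) @[t --> F] --> mdist x y.
Proof.
move=> uy; apply/cvgrPdist_lt => e e0.
have := metricType_numDomainType.cvgr_dist_lt (FF := FF) uy e0.
apply: filterS => t yt.
apply: le_lt_trans yt.
have := metric_triangle x (u t) y; have := metric_triangle x y (u t).
rewrite (metric_sym (u t) y) ler_norml; lra.
Qed.
Arguments cvg_mdistr {R X T F FF u} x {y}.

Lemma geodesic_from_to_exists {R : realType} {X : metricType R} (x y : X) :
  geodesic_space X -> exists g : R -> X, geodesic_from_to x y g.
Proof.
move=> /(_ x y)[a [b [g [[ab gd] ga gb]]]].
have dxy : mdist x y = b - a.
  rewrite -ga -gb gd ?in_itv/= ?lexx ?ab// distrC ger0_norm//.
  by rewrite subr_ge0.
(* Translating by [a] moves the domain to [[0, b - a]], whose length is d(x, y). *)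
exists (fun s => g (a + s)); split; last 2 first.
- by rewrite addr0.
- by rewrite dxy addrC subrK.
split=> [|s t]; first exact: mdist_ge0.
rewrite !in_itv/= dxy => /andP[s0 sb] /andP[t0 tb].
rewrite gd; first by congr `|_|; ring.
- by rewrite in_itv/=; apply/andP; split; lra.
- by rewrite in_itv/=; apply/andP; split; lra.
Qed.

Lemma CAT0_geo_comb {R : realType} {X : completeMetricType R} (t : R)
    (x y z : X) :
  CAT0 X -> 0 <= t <= 1 ->
  mdist z (geo_comb t x y) ^+ 2 <=
    (1 - t) * mdist z x ^+ 2 + t * mdist z y ^+ 2
    - t * (1 - t) * mdist x y ^+ 2.
Proof.
move=> catX t01; have [g gxy] := geodesic_from_to_exists x y catX.1.
rewrite (geo_combE catX t01 gxy); have [gg g0 g1] := gxy.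
by have := catX.2 z _ _ _ gg t t01; rewrite mulr0 add0r g0 g1.
Qed.

(** Restricting to points of finite value keeps the inequality in real arithmetic, which is all that
    the resolvent estimates use. *)
Definition geo_convex {R : realType} {X : completeMetricType R}
    (f : X -> \bar R) : Prop :=
  forall (x y : X) (r s t : R), 0 <= t <= 1 -> f x = r%:E -> f y = s%:E ->
  (f (geo_comb t x y) <= ((1 - t) * r + t * s)%:E)%E.

Lemma uniformly_convex_geo_convex {R : realType} {X : completeMetricType R}
    (f : X -> \bar R) (phi : R -> \bar R) :
  uniformly_convex f phi -> geo_convex f.
Proof.
move=> [[phi0 _ _] fuc] x y r s t t01 fx fy.
have /andP[t0 t1] := t01.
have := fuc x y t t01; rewrite fx fy -!EFinM -EFinD => /(_ isT).
move=> /le_trans; apply; rewrite geeDl// oppe_le0.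
by rewrite mule_ge0 ?phi0 ?mdist_ge0// lee_fin mulr_ge0 ?subr_ge0.
Qed.

(** * The resolvent: existence and basic inequality *)

Section resolvent.
Context {R : realType} {X : completeMetricType R}.
Variables (f : X -> \bar R).
Hypotheses (catX : CAT0 X) (fN : no_ninfty f) (f_convex : geo_convex f).

Lemma le_fin_value (y : X) (r : R) : (f y <= r%:E)%E ->
  exists2 s, f y = s%:E & s <= r.
Proof.
have := fN y; case: (f y) => [s||]//= _.
by rewrite lee_fin; exists s.
Qed.

(** The penalised value at the midpoint of y and z is at least m, while convexity and the CAT(0)
    inequality bound it by the average of the values at y and z minus c/4 d(y, z)^2. This makes
    minimizing sequences Cauchy. *)
Lemma minimizing_dist (c m r s : R) (x y z : X) :
  0 < c -> f y = r%:E -> f z = s%:E ->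
  (forall w u, f w = u%:E -> m <= u + c * mdist x w ^+ 2) ->
  c / 2 * mdist y z ^+ 2 <=
    (r + c * mdist x y ^+ 2 - m) + (s + c * mdist x z ^+ 2 - m).
Proof.
move=> c0 fy fz mle.
have h01 : 0 <= (2^-1 : R) <= 1 by apply/andP; split; lra.
have [u fu ule] := le_fin_value (f_convex h01 fy fz).
have cat := CAT0_geo_comb y z x catX h01.
have := mle _ _ fu; move: cat ule.
set D := mdist x (geo_comb _ _ _) ^+ 2.
rewrite -(ler_pM2l c0) => cat ule mD.
have := le_trans mD (lerD ule cat); lra.
Qed.

Hypothesis f_lsc : lower_semicontinuous f.

Lemma penalised_minimizer_exists (c : R) (x p : X) :
  0 < c -> Argmin f p -> proper_fun f ->
  Argmin (fun y => f y + (c * mdist x y ^+ 2)%:E)%E !=set0.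
Proof.
move=> c0 pmin [q fq].
have [fp fpE] : exists r, f p = r%:E.
  have := fN p; have := pmin q; have := fN q.
  by case: (f p) (f q) fq => [r||]// [s||]//=; exists r.
pose S :=
  [set v | exists y r, f y = r%:E /\ v = r + c * mdist x y ^+ 2].
have S_inf : has_inf S.
  split; first by exists (fp + c * mdist x p ^+ 2); exists p, fp.
  exists fp => _ [y [r [fy ->]]].
  have := pmin y; rewrite fpE fy lee_fin => fpr.
  by rewrite (le_trans fpr)// lerDl mulr_ge0 ?sqr_ge0// ltW.
set m := inf S.
have mle w u : f w = u%:E -> m <= u + c * mdist x w ^+ 2.
  by move=> fw; apply: (ge_inf S_inf.2); exists w, u.
have /choice[u uP] n : exists y : X, exists2 r, f y = r%:E &
    r + c * mdist x y ^+ 2 <= m + n.+1%:R^-1.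
  have n0 : 0 < n.+1%:R^-1 :> R by rewrite invr_gt0.
  have [_ [y [r [fy ->]]] /ltW yr] := inf_adherent n0 S_inf.
  by exists y, r.
clearbody m.
have inv_small (e : R) : 0 < e ->
    \forall n \near \oo, n.+1%:R^-1 < e :> R.
  by move=> e0; have := near_infty_natSinv_lt (PosNum e0).
have u_cauchy : cauchy (u @ \oo).
  apply: cauchy_exP => e e0.
  (* Two excesses below c/4 e^2 add up to less than c/2 e^2, so [minimizing_dist] yields d < e. *)
  have d0 : 0 < c / 4 * e ^+ 2 by rewrite mulr_gt0 ?exprn_gt0 ?divr_gt0.
  have sm := inv_small _ d0.
  near \oo => N; exists (u N).
  suff : \forall n \near \oo, ball (u N) e (u n) by [].
  near=> n; rewrite ballEmdist/=.
  have [r fN_ rle] := uP N; have [s fn sle] := uP n.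
  have Nd : N.+1%:R^-1 < c / 4 * e ^+ 2 by near: N.
  have nd : n.+1%:R^-1 < c / 4 * e ^+ 2 by near: n.
  have := minimizing_dist c0 fN_ fn mle => le_d.
  rewrite -(ltr_pXn2r (n := 2))// ?nnegrE ?mdist_ge0// ?ltW//.
  rewrite -(ltr_pM2l c0).
  move: rle sle Nd nd le_d.
  by set a := _.+1%:R^-1; set b := _.+1%:R^-1; lra.
pose y := lim (u @ \oo).
have uy : u @ \oo --> y by exact/cauchy_cvgP.
have dist_cvg : c * mdist x (u n) ^+ 2 - n.+1%:R^-1 @[n --> \oo]
    --> c * mdist x y ^+ 2 - 0.
  apply: cvgB; last exact: cvg_harmonic.
  apply: cvgM; first exact: cvg_cst.
  exact: (cvgM (cvg_mdistr x uy) (cvg_mdistr x uy)).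
suff yle : (f y + (c * mdist x y ^+ 2)%:E <= m%:E)%E.
  exists y => z; apply: le_trans yle _.
  case fz : (f z) => [s||]; last by have := fN z; rewrite fz.
    by rewrite -EFinD lee_fin; exact: mle.
  by rewrite addye// leey.
rewrite leNgt -lteBlDr//; apply/negP => ltfy.
(* A real [a] separates the two sides, also when [f y] is +oo. Eventually [f (u n)] exceeds [a] by
   semicontinuity, yet it is at most m + 1/(n+1) - c d(x, u n)^2, which is eventually below [a]. *)
have [a ma afy] : exists2 a, m - c * mdist x y ^+ 2 < a & (a%:E < f y)%E.
  case: (f y) ltfy => [r||]//; rewrite -EFinB ?lte_fin => lt_r.
    by exists ((m - c * mdist x y ^+ 2 + r) / 2); rewrite ?lte_fin; lra.
  by exists (m - c * mdist x y ^+ 2 + 1); rewrite ?ltry//; lra.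
have [V yV Va] := f_lsc afy.
have lim_gt : m - a < c * mdist x y ^+ 2 - 0 by lra.
near \oo => n.
have [r fn rle] := uP n.
have : (a%:E < f (u n))%E by apply: Va; near: n; exact: uy.
have : m - a < c * mdist x (u n) ^+ 2 - n.+1%:R^-1.
  by near: n; exact: cvgr_gt dist_cvg _ lim_gt.
move: rle; rewrite fn lte_fin; set d := _.+1%:R^-1; lra.
Unshelve. all: by end_near. Qed.

Hypothesis f_proper : proper_fun f.

Lemma penalised_minimizer_ineq (c r s : R) (x y z : X) :
  0 < c -> Argmin (fun y => f y + (c * mdist x y ^+ 2)%:E)%E y ->
  f y = r%:E -> f z = s%:E ->
  r + c * mdist x y ^+ 2 + c * mdist y z ^+ 2 <= s + c * mdist x z ^+ 2.
Proof.
move=> c0 ymin fy fz; apply/ler_addgt0Pr => e e0.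
set K := c * mdist y z ^+ 2.
have K0 : 0 <= K by rewrite mulr_ge0 ?sqr_ge0// ltW.
(* The error left after dividing by t is t K; this t makes it at most e, and K + 1 avoids a zero
   denominator. *)
pose t := Num.min 1 (e / (K + 1)).
have t0 : 0 < t by rewrite lt_min ltr01 divr_gt0// ltr_wpDl.
have t1 : t <= 1 by rewrite ge_min lexx.
have t01 : 0 <= t <= 1 by rewrite ltW.
have tK : t * K <= e.
  have te : t * (K + 1) <= e.
    by rewrite -ler_pdivlMr ?ltr_wpDl// ge_min lexx orbT.
  by apply: le_trans te; rewrite ler_pM2l// lerDl.
have [u fu ule] := le_fin_value (f_convex t01 fy fz).
have := ymin (geo_comb t y z); rewrite fy fu -!EFinD lee_fin => rle.
have := CAT0_geo_comb y z x catX t01; rewrite -(ler_pM2l c0) => cat.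
(* Minimality of y against (1 - t) y + t z, after cancelling the (1 - t) parts; the CAT(0) term
   contributes t (1 - t) K. *)
have : t * (r + c * mdist x y ^+ 2 + K) <=
    t * (s + c * mdist x z ^+ 2 + t * K).
  move: (le_trans rle (lerD ule cat)); rewrite /K; lra.
by rewrite ler_pM2l//; lra.
Qed.

(** The minimizer [p] bounds f from below, so the [get] in [resolvent] returns a true minimizer;
    multiplying the penalised inequality by 2g clears the weight. *)
Lemma resolvent_ineq (g : R) (x p : X) : 0 < g -> Argmin f p ->
  exists2 r, f (resolvent f g x) = r%:E &
    forall z s, f z = s%:E ->
      2 * g * (r - s) + mdist x (resolvent f g x) ^+ 2
        + mdist (resolvent f g x) z ^+ 2 <= mdist x z ^+ 2.
Proof.
move=> g0 pmin.
have c0 : 0 < (2 * g)^-1 by rewrite invr_gt0 mulr_gt0.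
have [y0 y0min] := penalised_minimizer_exists x c0 pmin f_proper.
have ymin := getPex (ex_intro _ _ y0min).
rewrite -/(resolvent f g x) in ymin; set y := resolvent f g x in ymin *.
have [r fy] : exists r, f y = r%:E.
  have [q fq] := f_proper; have := ymin q; have := fN y; have := fN q.
  by case: (f y) (f q) fq => [r||]// [s||]//=; exists r.
exists r => // z s fz.
have := penalised_minimizer_ineq c0 ymin fy fz.
rewrite -(ler_pM2l (x := 2 * g)) ?mulr_gt0// !mulrDr.
by rewrite !(mulVKf (x := 2 * g)) ?gt_eqF ?mulr_gt0//; lra.
Qed.

End resolvent.

(** * Function values along the algorithm *)

Section proximal_point.
Context {R : realType} {X : completeMetricType R}.
Variables (f : X -> \bar R) (gam : nat -> R) (x p : X).
Hypotheses (catX : CAT0 X) (fN : no_ninfty f) (f_proper : proper_fun f).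
Hypotheses (f_lsc : lower_semicontinuous f) (f_convex : geo_convex f).
Hypotheses (pmin : Argmin f p) (gam0 : forall n, 0 < gam n).

(** The index starts at n + 1 because [f x] itself may be +oo, whereas resolvents have finite
    value. *)
Lemma prox_point_value (m : R) (n : nat) : f p = m%:E ->
  exists2 r, f (prox_point f gam x n.+1) = r%:E &
    2 * (r - m) * \sum_(0 <= i < n.+1) gam i
      + mdist (prox_point f gam x n.+1) p ^+ 2 <= mdist x p ^+ 2.
Proof.
move=> fp.
pose u := prox_point f gam x.
have resP k : exists2 r, f (u k.+1) = r%:E & forall z s, f z = s%:E ->
    2 * gam k * (r - s) + mdist (u k.+1) z ^+ 2 <= mdist (u k) z ^+ 2.
  have [r fr rle] := resolvent_ineq catX fN f_convex f_lsc f_proper (u k)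
    (gam0 k) pmin.
  exists r => // z s fz; apply: le_trans (rle z s fz).
  by rewrite lerD2r lerDl sqr_ge0.
rewrite -/u; elim: n => [|n [r fr IH]].
  have [r fr rle] := resP 0%N; exists r => //.
  by rewrite big_nat1; have := rle _ _ fp; rewrite -/(u 0%N); lra.
have [s fs sle] := resP n.+1; exists s => //.
rewrite big_nat_recr//=; set S := \sum_(_ <= _ < _) _ in IH *.
have S0 : 0 <= S by apply: sumr_ge0 => i _; exact: ltW.
(* The resolvent inequality with z the previous iterate. *)
have sr : s <= r.
  have := sle _ _ fr; rewrite mdistxx expr0n/= => le0.
  have : 2 * gam n.+1 * (s - r) <= 0.
    by have := sqr_ge0 (mdist (u n.+2) (u n.+1)); lra.
  by rewrite pmulr_rle0 ?mulr_gt0// subr_le0.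
(* By this decrease, the new gap s - m may replace r - m in front of the earlier step sizes. *)
have := ler_wpM2r S0 sr.
by have := sle _ _ fp; lra.
Qed.

End proximal_point.

(** * Partial sums of the step sizes *)

Section rate.
Context {R : realType}.

Lemma le_ceiln (r : R) : 0 <= r -> r <= (ceiln r)%:R.
Proof.
move=> r0; rewrite /ceiln natr_absz ger0_norm ?ceil_ge//.
by rewrite ceil_ge0 (lt_le_trans _ r0)// ltrN10.
Qed.

Lemma leq_hmax (h : nat -> nat) (n : nat) : (h n <= hmax h n)%N.
Proof. exact: (leq_bigmax (F := fun i : 'I_n.+1 => h i) ord_max). Qed.

(** The [+ 1] in [beta_rate] is the index shift: the iterate n + 1 has used the step sizes 0 to
    n. *)
Lemma beta_rate_sum (b : R) (gam : nat -> R) (theta : nat -> nat) (k n : nat) :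
  (forall n, 0 < gam n) -> rate_of_divergence gam theta ->
  (beta_rate b theta k <= n.+1)%N ->
  b ^+ 2 * k.+1%:R <= 2 * \sum_(0 <= i < n.+1) gam i.
Proof.
move=> gam0 th; rewrite /beta_rate addn1 ltnS => kn.
set P := ceiln _ in kn.
have thn : (theta P <= n)%N by rewrite (leq_trans _ kn)// leq_hmax.
have leP : b ^+ 2 * k.+1%:R / 2 <= P%:R.
  by apply: le_ceiln; rewrite divr_ge0// mulr_ge0// sqr_ge0.
have le_sum : \sum_(0 <= i < (theta P).+1) gam i <= \sum_(0 <= i < n.+1) gam i.
  rewrite [leRHS](@big_cat_nat _ _ _ (theta P).+1)//= lerDl.
  by apply: sumr_ge0 => i _; exact: ltW.
by have := le_trans (th P) le_sum; lra.
Qed.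

End rate.

(** * Uniform convexity and the rate of convergence *)

Lemma uniformly_convex_dist {R : realType} {X : completeMetricType R}
    (f : X -> \bar R) (phi : R -> \bar R) (y p : X) (r m : R) :
  uniformly_convex f phi -> Argmin f p -> f y = r%:E -> f p = m%:E ->
  (phi (mdist y p) <= (2 * (r - m))%:E)%E.
Proof.
move=> [[phi0 _ _] fuc] pmin fy fp.
have h01 : 0 <= (2^-1 : R) <= 1 by apply/andP; split; lra.
have := fuc y p _ h01; rewrite fy fp -!EFinM -EFinD => /(_ isT).
have := pmin (geo_comb 2^-1 y p); rewrite fp => /le_trans /[apply].
(* For a finite value v this reads m <= (r + m)/2 - v/4; the value +oo would force m <= -oo. *)
have := phi0 _ (mdist_ge0 y p); case: (phi _) => [v||]//= _.
  by rewrite !lee_fin; lra.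
by rewrite gt0_muley// lte_fin; lra.
Qed.

Theorem theorem3p1 (R : realType) (X : completeMetricType R)
    (f : X -> \bar R) (phi : R -> \bar R) (x : X) (b : R)
    (gam : nat -> R) (theta : nat -> nat) :
  CAT0 X ->
  no_ninfty f -> proper_fun f -> lower_semicontinuous f ->
  Argmin f !=set0 ->
  uniformly_convex f phi ->
  0 < b ->
  (exists2 p, Argmin f p & mdist x p <= b) ->
  (forall n, 0 < gam n) ->
  (\sum_(0 <= n <oo) (gam n)%:E = +oo)%E ->
  rate_of_divergence gam theta ->
  exists l : X,
    [/\ prox_point f gam x n @[n --> \oo] --> l,
        rate_of_convergence (prox_point f gam x) l (Sigma_rate b theta phi) &
        Argmin f l].
Proof.
move=> catX fN f_proper f_lsc _ f_uc b0 [p pmin xpb] gam0 _ th.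
have f_convex := uniformly_convex_geo_convex f_uc.
have [[phi0 phi_mono phi_eq0] _] := f_uc.
have [m fp] : exists m, f p = m%:E.
  have [q fq] := f_proper; have := pmin q; have := fN p; have := fN q.
  by case: (f p) (f q) fq => [v||]// [w||]//=; exists v.
have rate : rate_of_convergence (prox_point f gam x) p (Sigma_rate b theta phi).
  (* Index 0 is vacuous, since [Sigma_rate] is at least 1. *)
  move=> k [|n]; first by rewrite /Sigma_rate /beta_rate addn1.
  move=> /(beta_rate_sum gam0 th).
  set K := ceiln _; set S := \sum_(_ <= _ < _) _ => leS.
  have [r fr] := prox_point_value x catX fN f_proper f_lsc
    f_convex pmin gam0 n fp.
  rewrite -/S; set y := prox_point f gam x n.+1 in fr * => leb.
  set e := k.+1%:R^-1 in K leS *.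
  have e0 : 0 < e by rewrite invr_gt0.
  (* If d(y, p) > e, then v = phi(e) is positive and at most 2 (r - m), hence finite. The two bounds
     on S give (r - m)(K + 1) <= 1, so 8 <= v K <= 2 (r - m) K < 2, a contradiction. *)
  rewrite leNgt; apply/negP => /ltW elt.
  have := le_trans (phi_mono _ _ (ltW e0) elt)
    (uniformly_convex_dist f_uc pmin fr fp).
  have : phi e != 0%E.
    by apply/eqP => /(phi_eq0 _ (ltW e0)) e_eq0; rewrite e_eq0 ltxx in e0.
  have := phi0 _ (ltW e0).
  case phie : (phi e) => [v||]//; rewrite lee_fin => v0 vN0 vle.
  have {v0 vN0}v0 : 0 < v by rewrite lt_neqAle eq_sym v0 andbT.
  have K8 : 8 / v <= K%:R.
    by rewrite /K phie inver gt_eqF//=; apply: le_ceiln; rewrite divr_ge0// ltW.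
  have rm : 0 < r - m by move: vle; rewrite lee_fin; lra.
  have bS : 2 * (r - m) * S <= b ^+ 2.
    apply: (@le_trans _ _ (mdist x p ^+ 2)).
      by apply: le_trans leb; rewrite lerDl sqr_ge0.
    by rewrite ler_pXn2r// nnegrE ?mdist_ge0// ltW.
  have : (r - m) * (b ^+ 2 * K.+1%:R) <= b ^+ 2 * 1.
    by have := ler_wpM2l (ltW rm) leS; lra.
  rewrite mulrCA ler_pM2l ?exprn_gt0// -natr1 => rK.
  move: vle K8; rewrite lee_fin ler_pdivrMr// => vle K8.
  have := ler_wpM2l (ler0n R K) vle; lra.
exists p; split => //.
apply/metricType_numDomainType.cvgrPdist_lt => e e0.
near \oo => k.
near=> n; apply: (@le_lt_trans _ _ k.+1%:R^-1).
  by rewrite metric_sym; apply: rate; near: n; exact: nbhs_infty_ge.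
by near: k; exact: (near_infty_natSinv_lt (PosNum e0)).
Unshelve. all: by end_near. Qed.
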